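(* Let $K\ge 2$, let $\Theta=\{(\theta_1,\ldots,\theta_K):\sum_{k=1}^K\theta_k=1,\ \theta_k\ge 0\}$ be the $(K-1)$-simplex, and let $X_1,\ldots,X_n\in\{1,\ldots,K\}$ be an observed sample from $\mathrm{Multinomial}(1,\theta_1,\ldots,\theta_K)$ (i.e. i.i.d. with $\Pr(X_i=k\mid\theta)=\theta_k$). Consider the random set $$\mathbf e_X(U)=\{\theta\in\Theta:\ \theta_{X_i}>U_i,\ i=1,\ldots,n\},$$ where $U=(U_1,\ldots,U_n)$ has the law of $n$ i.i.d. $\mathrm{Unif}(0,1)$ variables conditioned on the event $\mathbf e_X(U)\neq\emptyset$. Then this random set is distributed as $$\mathbf e_N(Z)=\{\theta\in\Theta:\ \theta_1\ge Z_1,\ldots,\theta_K\ge Z_K\},$$ where $(Z_0,Z_1,\ldots,Z_K)\sim\mathrm{Dirichlet}(1,N_1,\ldots,N_K)$ and $N_k=\#\{i: X_i=k\}$ are the cell counts, $k=1,\ldots,K$. Here $Z_k=0$ with probability one if and only if $N_k=0$.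
   Context: The Dirichlet distribution with some parameters equal to zero is understood in the degenerate sense: a coordinate whose parameter is $0$ equals $0$ almost surely, and the remaining coordinates follow the Dirichlet distribution with the positive parameters. *)

(* Defs.v *)
From HB Require Import structures.
From mathcomp Require Import all_boot all_order all_algebra.
From mathcomp Require Import all_classical all_reals all_analysis.
Set Implicit Arguments. Unset Strict Implicit. Unset Printing Implicit Defensive.
Import Order.TTheory GRing.Theory Num.Theory.
Local Open Scope classical_set_scope.
Local Open Scope ring_scope.

(* Vectors of reals are encoded as functions nat -> R (unused coordinates are 0). *)
Definition scons {R : realType} (x : R) (v : nat -> R) : nat -> R :=
  fun i => if i is j.+1 then v j else x.

(* Iterated Lebesgue integral over the coordinates flagged [true] in [m]
   (coordinate i is the i-th entry of m); coordinates flagged [false] are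
   set to 0 (degenerate/Dirac coordinates).  With m = nseq n true this is
   integration against n-dimensional Lebesgue measure (Tonelli). *)
Fixpoint iint {R : realType} (m : seq bool) (f : (nat -> R) -> \bar R) : \bar R :=
  match m with
  | [::] => f (fun _ => 0)
  | b :: m' =>
      if b then (\int[@lebesgue_measure R]_(x in setT) iint m' (fun v => f (scons x v)))%E
      else iint m' (fun v => f (scons 0 v))
  end.

Definition indE {R : realType} (P : Prop) : \bar R := if `[< P >] then 1%E else 0%E.

Definition simplex {R : realType} (K : nat) : set ('I_K -> R) :=
  [set th | (forall k, 0 <= th k) /\ \sum_(k < K) th k = 1].

Definition eX {R : realType} (n K : nat) (X : 'I_n -> 'I_K) (u : nat -> R)
  : set ('I_K -> R) :=
  [set th | simplex th /\ forall i : 'I_n, u i < th (X i)].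

(* e_N(Z) = {theta in Theta : theta_k >= Z_k, k = 1..K}; here z (k-1) = Z_k. *)
Definition eN {R : realType} (K : nat) (z : nat -> R) : set ('I_K -> R) :=
  [set th | simplex th /\ forall k : 'I_K, z k <= th k].

Definition cellcount (n K : nat) (X : 'I_n -> 'I_K) (k : 'I_K) : nat :=
  #|[set i | X i == k]|.

Definition unif_cond_prob {R : realType} (n K : nat) (X : 'I_n -> 'I_K)
  (A : set (nat -> R)) : R :=
  let E := [set u : nat -> R | eX X u !=set0] in
  let box := [set u : nat -> R | forall i, (i < n)%N -> 0 <= u i <= 1] in
  fine (iint (nseq n true) (fun u => indE (box u /\ E u /\ A u)))
  / fine (iint (nseq n true) (fun u => indE (box u /\ E u))).

(* Law of (Z_1..Z_K) where (Z_0,Z_1..Z_K) ~ Dirichlet(1, N_1..N_K), in the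
   degenerate sense: Z_k = 0 a.s. when N_k = 0, and the coordinates with
   N_k > 0 (together with Z_0 = 1 - sum Z_k) have the Dirichlet density
   proportional to z_0^(1-1) * prod_{N_k>0} z_k^(N_k-1) on the simplex. *)
Definition dirichlet_prob {R : realType} (K : nat) (N : 'I_K -> nat)
  (A : set (nat -> R)) : R :=
  let mask := [seq (0 < N k)%N | k <- enum 'I_K] in
  let dom := [set z : nat -> R | (forall k : 'I_K, 0 <= z k) /\ \sum_(k < K) z k <= 1] in
  let w := fun z : nat -> R => \prod_(k < K | (0 < N k)%N) z k ^+ (N k).-1 in
  fine (iint mask (fun z => indE (dom z /\ A z) * (w z)%:E)%E)
  / fine (iint mask (fun z => indE (dom z) * (w z)%:E)%E).

(* Main.v *)
Require Import Defs.
From HB Require Import structures.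
From mathcomp Require Import all_boot all_order all_algebra.
From mathcomp Require Import all_classical all_reals all_analysis.
From mathcomp Require Import measurable_realfun.
Set Implicit Arguments. Unset Strict Implicit. Unset Printing Implicit Defensive.
Import Order.TTheory GRing.Theory Num.Theory.
Import numFieldNormedType.Exports.
Local Open Scope classical_set_scope.
Local Open Scope ring_scope.

(** Almost everything about the sample is contained in the maxima
    [M_k = max {U_i : X_i = k}] (with [M_k = 0] if [N_k = 0]): the set [e_X(U)]
    is nonempty iff [\sum_k M_k < 1], and it is [{theta : theta_k > M_k}] over
    the [k] with [N_k > 0].  Adding one observation [X_i = k] replaces the
    coordinate [z_k] of the vector of maxima by [max(z_k, U_i)]; let [maxstep k]
    be the averaging operator of this move.  By Tonelli these operators
    commute, so the observations can be sorted by category, and the [N]-th power of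
    [maxstep k] at [z_k = 0] is integration of [z_k] against
    [N x^(N-1) dx] on [[0, 1]].  Hence [M] has, up to the factor [\prod_k N_k],
    the weight [\prod_k z_k^(N_k-1)] of the Dirichlet law, restricted to
    [\sum_k z_k < 1] by the conditioning.  Strict and weak inequalities differ
    on a null set only. *)

(** * One-dimensional integrals: the law of a maximum of uniform variables *)

Section OneDimension.
Variable R : realType.
Local Notation mu := (@lebesgue_measure R).
Local Notation J x := ((\1_`[0%R, 1%R]%classic x : R)%:E).

Lemma integral_exprn (N : nat) (x : R) : 0 <= x ->
  (\int[mu]_(t in `[0%R, x]) (N.+1%:R * t ^+ N)%:E = (x ^+ N.+1)%:E)%E.
Proof.
rewrite le_eqVlt => /predU1P[<-|x0].
  by rewrite set_itv1 integral_set1 expr0n.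
rewrite (@continuous_FTC2 _ _ (fun t : R => t ^+ N.+1)) //.
- by rewrite expr0n/= sube0.
- apply: continuous_subspaceT => t.
  by apply: cvgM; [exact: cvg_cst|exact: exprn_continuous].
- split.
  + by move=> t _; exact: exprn_derivable.
  + by apply: cvg_at_right_filter; exact: exprn_continuous.
  + by apply: cvg_at_left_filter; exact: exprn_continuous.
- by move=> t _; rewrite exp_derive1.
Qed.

Lemma measurable_indicE (A : set R) : measurable A ->
  measurable_fun setT (fun x : R => ((\1_A x : R)%:E)).
Proof. by move=> mA; apply/measurable_EFinP; exact: measurable_indic. Qed.

(** Split the unit interval at [t]: on [[0, t[], of length [t], the maximum is constantly [t], and
    beyond [t] it is [x] itself. *)
Lemma integral_max (h : R -> \bar R) (t : R) :
  measurable_fun setT h -> (forall x, 0 <= h x)%E -> 0 <= t <= 1 ->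
  (\int[mu]_x (J x * h (Num.max t x)) =
   t%:E * h t + \int[mu]_x (J x * (\1_`[t, +oo[%classic x)%:E * h x))%E.
Proof.
move=> mh h0 /andP[t0 t1].
have mI A : measurable A -> measurable_fun setT (fun x : R => ((\1_A x : R)%:E)).
  exact: measurable_indicE.
transitivity (\int[mu]_x ((\1_`[0%R, t[%classic x)%:E * h t +
   J x * (\1_`[t, +oo[%classic x)%:E * h x))%E.
  apply: eq_integral => x _; rewrite !indicE !mem_setE !in_itv/= andbT.
  case: (leP t x) => tx.
    by rewrite andbF mul0e add0e mule1.
  rewrite andbT (le_trans (ltW tx) t1) andbT.
  by rewrite mule0 mul0e adde0.
have mt : lebesgue_measure (`[0%R, t[%classic : set R) = t%:E.
  rewrite lebesgue_measure_itv/= lte_fin; case: ltP => [_|t0']; first by rewrite sube0.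
  by congr (_%:E); apply/le_anti/andP.
rewrite ge0_integralD//.
- congr (_ + _)%E.
  rewrite ge0_integralZr//; last by apply: mI.
  by rewrite integral_indic// setIT; congr (_ * _)%E; exact: mt.
- by move=> x _; rewrite mule_ge0// lee_fin.
- by apply: emeasurable_funM => //; exact: mI.
- by move=> x _; rewrite !mule_ge0// lee_fin.
- by apply: emeasurable_funM => //; apply: emeasurable_funM; exact: mI.
Qed.

(** Induction step for the density of a maximum. A new uniform value lies below the old maximum t
    with probability t, which contributes (N+1) t^(N+1); the old maximum lies below the new value x
    with probability x^(N+1). The sum is the density (N+2) x^(N+1). *)
Lemma integral_max_exprn (N : nat) (h : R -> \bar R) :
  measurable_fun setT h -> (forall x, 0 <= h x)%E ->
  (\int[mu]_t (J t * (N.+1%:R * t ^+ N)%:E *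
      \int[mu]_x (J x * h (Num.max t x))) =
   \int[mu]_t (J t * (N.+2%:R * t ^+ N.+1)%:E * h t))%E.
Proof.
move=> mh h0.
have mI A : measurable A -> measurable_fun setT (fun x : R => ((\1_A x : R)%:E)).
  exact: measurable_indicE.
have mX (a : R) k : measurable_fun setT (fun x : R => (a * x ^+ k)%:E).
  by apply/measurable_EFinP; apply: measurable_funM => //; exact: measurable_funX.
have J0 (x : R) : (0 <= J x)%E by rewrite lee_fin.
have JX0 (a x : R) k : 0 <= a -> (0 <= J x * (a * x ^+ k)%:E)%E.
  move=> a0; rewrite indicE mem_setE in_itv/=.
  by case: (boolP (0 <= x <= 1)) => [/andP[x0 _]|_];
    rewrite ?mul0e// mul1e lee_fin mulr_ge0// exprn_ge0.
(* [F] is the contribution of the region where the new value [p.2] is at least the old maximum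
   [p.1]; Tonelli will integrate it over [p.1] first. *)
pose F (p : R * R) : \bar R := (J p.1 * (N.+1%:R * p.1 ^+ N)%:E *
  (J p.2 * ((p.1 <= p.2)%R%:R)%:E * h p.2))%E.
have F0 p : (0 <= F p)%E by apply: mule_ge0; [exact: JX0|rewrite !mule_ge0// lee_fin].
have mF : measurable_fun setT F.
  apply: emeasurable_funM; first apply: emeasurable_funM.
  - by apply: (measurableT_comp (mI _ _)).
  - exact: (measurableT_comp (mX N.+1%:R N)).
  - apply: emeasurable_funM; last exact: measurableT_comp.
    apply: emeasurable_funM; first by apply: (measurableT_comp (f := fun x : R => J x)) => //; exact: mI.
    apply/measurable_EFinP.
    apply: (measurableT_comp (f := fun b : bool => b%:R : R)) => //.
    exact: measurable_fun_ler.
transitivity (\int[mu]_t (J t * (N.+1%:R * t ^+ N.+1)%:E * h t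
    + \int[mu]_x F (t, x)))%E.
  apply: eq_integral => t _; rewrite /F/=.
  case: (boolP (0 <= t <= 1)) => t01; last first.
    rewrite indicE mem_setE in_itv/= (negbTE t01) !mul0e add0e integral0_eq//.
    by move=> x _; rewrite !mul0e.
  rewrite ge0_integralZl//; last 3 first.
  - do 2 apply: emeasurable_funM => //; first exact: mI.
    apply/measurable_EFinP.
    apply: (measurableT_comp (f := fun b : bool => b%:R : R)) => //.
    exact: measurable_fun_ler.
  - by move=> x _; rewrite !mule_ge0// lee_fin.
  - exact: JX0.
  rewrite (integral_max mh)// indicE mem_setE in_itv/= t01 !mul1e.
  rewrite ge0_muleDr//.
  - rewrite muleA -EFinM -mulrA -exprSr; congr (_ + _ * _)%E.
    apply: eq_integral => x _; congr (_ * _ * _)%E.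
    by rewrite [in LHS]indicE mem_setE in_itv/= andbT.
  - by rewrite mule_ge0// lee_fin; case/andP: t01.
  - by apply: integral_ge0 => x _; rewrite !mule_ge0// lee_fin.
rewrite ge0_integralD//; last 4 first.
- by move=> x _; rewrite mule_ge0// JX0.
- by apply: emeasurable_funM => //; apply: emeasurable_funM; [exact: mI|exact: mX].
- by move=> t _; apply: integral_ge0 => x _; exact: F0.
- exact: measurable_fun_fubini_tonelli_F.
rewrite fubini_tonelli//.
(* The target coefficient N+2 is split as (N+1) + 1 to match the two contributions. *)
transitivity (\int[mu]_t (J t * (N.+1%:R * t ^+ N.+1)%:E * h t) +
  \int[mu]_x (J x * (1 * x ^+ N.+1)%:E * h x))%E; last first.
  rewrite -ge0_integralD//.
  - apply: eq_integral => x _.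
    rewrite -ge0_muleDl ?JX0// -[(N.+2)]addn1 natrD mulrDl EFinD.
    by rewrite indicE mem_setE in_itv/=; case: (0 <= x <= 1) => /=;
      rewrite ?mul1e ?(mul0e, adde0)// !(mul0e, adde0).
  - by move=> x _; rewrite mule_ge0// JX0.
  - by apply: emeasurable_funM => //; apply: emeasurable_funM; [exact: mI|exact: mX].
  - by move=> x _; rewrite mule_ge0// JX0.
  - by apply: emeasurable_funM => //; apply: emeasurable_funM; [exact: mI|exact: mX].
congr (_ + _)%E; apply: eq_integral => x _; rewrite /F/=.
case: (boolP (0 <= x <= 1)) => x01; last first.
  rewrite indicE mem_setE in_itv/= (negbTE x01) !mul0e integral0_eq//.
  by move=> t _; rewrite !(mul0e, mule0).
rewrite [in RHS]indicE mem_setE in_itv/= x01 mul1e mul1r.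
case/andP: (x01) => x0 x1.
rewrite -(integral_exprn N x0) [X in (X * _)%E]integral_mkcond.
rewrite -ge0_integralZr//.
- apply: eq_integral => t _.
  rewrite patchE !indicE !mem_setE !in_itv/= x01 mul1e.
  case: (leP t x) => tx; rewrite ?andbT ?andbF ?mul0e ?mule0//.
  rewrite (le_trans tx x1) andbT mul1e.
  by case: (0 <= t); rewrite ?mul0e// mul1e.
- apply/(measurable_restrictT _ _).1 => //.
  apply: measurable_funTS; exact: mX.
- by move=> t _; apply: erestrict_ge0 => s /=; rewrite in_itv/= => /andP[s0 _];
  rewrite lee_fin mulr_ge0// exprn_ge0.
Qed.
End OneDimension.

(** * Measurability of functions of finitely many coordinates and of iterated integrals *)

Section JointMeasurability.
Variable R : realType.
Local Notation mu := (@lebesgue_measure R).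

(* [nat -> R] carries no sigma-algebra here: measurability of [g] is tested on
   all maps into [nat -> R] with measurable coordinates. *)
Definition measurable_coords d (T : measurableType d) (phi : T -> nat -> R) :=
  forall i, measurable_fun setT (fun t => phi t i).

Definition jmeasurable (g : (nat -> R) -> \bar R) :=
  forall d (T : measurableType d) (phi : T -> nat -> R),
    measurable_coords phi -> measurable_fun setT (fun t => g (phi t)).

Definition upd (z : nat -> R) (k : nat) (x : R) : nat -> R :=
  fun i => if i == k then x else z i.

Lemma upd_eq z k x : upd z k x k = x.
Proof. by rewrite /upd eqxx. Qed.

Lemma upd_upd z k x y : upd (upd z k x) k y = upd z k y.
Proof. by apply/funext => i; rewrite /upd; case: eqP. Qed.

Lemma updC z j k x y : j != k -> upd (upd z j x) k y = upd (upd z k y) j x.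
Proof.
move=> jk; apply/funext => i; rewrite /upd; case: eqP => // ->.
by rewrite eq_sym (negbTE jk).
Qed.

Lemma measurable_coords_upd d (T : measurableType d) (phi : T -> nat -> R) k
    (x : T -> R) : measurable_coords phi -> measurable_fun setT x ->
  measurable_coords (fun t => upd (phi t) k (x t)).
Proof. by move=> mphi mx i; rewrite /upd; case: (i == k). Qed.

Lemma measurable_coords_scons d (T : measurableType d) (phi : T -> nat -> R)
    (x : T -> R) : measurable_coords phi -> measurable_fun setT x ->
  measurable_coords (fun t => scons (x t) (phi t)).
Proof. by move=> mphi mx [|i] /=. Qed.

Lemma jmeasurable_scons g : jmeasurable g ->
  forall d (T : measurableType d) (phi : T -> nat -> R) (x : T -> R),
  measurable_coords phi -> measurable_fun setT x ->
  measurable_fun setT (fun t => g (scons (x t) (phi t))).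
Proof. by move=> mg d T phi x mphi mx; apply: mg; exact: measurable_coords_scons. Qed.

Lemma jmeasurable_sconsx g x : jmeasurable g -> jmeasurable (fun v => g (scons x v)).
Proof. by move=> mg d T phi mphi; apply: (jmeasurable_scons mg). Qed.

Lemma jmeasurableM g h : jmeasurable g -> jmeasurable h ->
  jmeasurable (fun z => g z * h z)%E.
Proof. by move=> mg mh d T phi mphi; apply: emeasurable_funM; [exact: mg|exact: mh]. Qed.

Lemma jmeasurable_cst c : jmeasurable (fun=> c).
Proof. by move=> d T phi _; exact: measurable_cst. Qed.

Lemma jmeasurable_integral (G : R -> (nat -> R) -> \bar R) :
  (forall x z, 0 <= G x z)%E ->
  (forall d (T : measurableType d) (phi : T -> nat -> R) (x : T -> R),
     measurable_coords phi -> measurable_fun setT x ->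
     measurable_fun setT (fun t => G (x t) (phi t))) ->
  jmeasurable (fun z => \int[mu]_x G x z)%E.
Proof.
move=> G0 mG d T phi mphi.
pose F (p : T * measurableTypeR R) := G p.2 (phi p.1).
have mF : measurable_fun setT F.
  apply: (mG _ _ (fun p : T * measurableTypeR R => phi p.1) snd) => // i.
  exact: measurableT_comp (mphi i) _.
exact: (@measurable_fun_fubini_tonelli_F _ _ _ _ _ mu _ mF (fun p => G0 _ _)).
Qed.

Lemma indE_ge0 (P : Prop) : (0 <= indE P :> \bar R)%E.
Proof. by rewrite /indE; case: asboolP. Qed.

Definition jmeasurable_set (P : (nat -> R) -> Prop) :=
  forall d (T : measurableType d) (phi : T -> nat -> R),
    measurable_coords phi -> measurable [set t | P (phi t)].

Lemma jmeasurable_indE P : jmeasurable_set P -> jmeasurable (fun z => indE (P z)).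
Proof.
move=> mP d T phi mphi.
have -> : (fun t => indE (P (phi t))) = (EFin \o \1_[set t | P (phi t)] : T -> \bar R).
  apply/funext => t; rewrite /indE /= indicE.
  by case: asboolP => h; [rewrite mem_set|rewrite memNset].
by apply/measurable_EFinP; apply: measurable_indic; exact: mP.
Qed.

Lemma jmeasurable_setI P Q : jmeasurable_set P -> jmeasurable_set Q ->
  jmeasurable_set (fun z => P z /\ Q z).
Proof. by move=> mP mQ d T phi mphi; apply: measurableI; [exact: mP|exact: mQ]. Qed.

Lemma jmeasurable_setC P : jmeasurable_set P -> jmeasurable_set (fun z => ~ P z).
Proof. by move=> mP d T phi mphi; apply: measurableC; exact: mP. Qed.

Lemma jmeasurable_set_cst P : jmeasurable_set (fun=> P).
Proof.
move=> d T phi mphi; have [p|np] := pselect P.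
- by rewrite [X in measurable X](_ : _ = setT)//; apply/seteqP; split.
- by rewrite [X in measurable X](_ : _ = set0)//; apply/seteqP; split.
Qed.

Lemma jmeasurable_set_imply (A : Prop) P : jmeasurable_set P ->
  jmeasurable_set (fun z => A -> P z).
Proof.
move=> mP; have [a|na] := pselect A.
- rewrite (_ : (fun z => A -> P z) = P)//.
  by apply/funext => z; apply/propext; split => // /(_ a).
- rewrite (_ : (fun z => A -> P z) = fun=> True); first exact: jmeasurable_set_cst.
  by apply/funext => z; apply/propext; split.
Qed.

Lemma jmeasurable_set_forall (I : finType) (P : I -> (nat -> R) -> Prop) :
  (forall i, jmeasurable_set (P i)) -> jmeasurable_set (fun z => forall i, P i z).
Proof.
move=> mP d T phi mphi.
rewrite [X in measurable X](_ : _ = \bigcap_(i in [set: I]) [set t | P i (phi t)]).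
  by apply: fin_bigcap_measurable => // i _; exact: mP.
by apply/seteqP; split => t /= h i; [move=> _|]; apply: h.
Qed.

Lemma jmeasurable_set_iff P (b : bool) : jmeasurable_set P ->
  jmeasurable_set (fun z => P z <-> b).
Proof.
move=> mP; case: b.
- rewrite (_ : (fun z => _) = P)//.
  by apply/funext => z; apply/propext; split => [h|]; [apply/h|].
- rewrite (_ : (fun z => _) = fun z => ~ P z); first exact: jmeasurable_setC.
  by apply/funext => z; apply/propext; split => [h|]; [move/h|].
Qed.

Definition jmeasurable_fun (f : (nat -> R) -> R) :=
  forall d (T : measurableType d) (phi : T -> nat -> R),
    measurable_coords phi -> measurable_fun setT (fun t => f (phi t)).

Lemma jmeasurable_ler f g : jmeasurable_fun f -> jmeasurable_fun g ->
  jmeasurable_set (fun z => f z <= g z).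
Proof.
move=> mf mg d T phi mphi; rewrite -[X in measurable X]setTI.
exact: (measurable_fun_ler (mf _ _ _ mphi) (mg _ _ _ mphi) measurableT (Y := [set true])).
Qed.

Lemma jmeasurable_ltr f g : jmeasurable_fun f -> jmeasurable_fun g ->
  jmeasurable_set (fun z => f z < g z).
Proof.
move=> mf mg d T phi mphi; rewrite -[X in measurable X]setTI.
exact: (measurable_fun_ltr (mf _ _ _ mphi) (mg _ _ _ mphi) measurableT (Y := [set true])).
Qed.

Lemma jmeasurable_fun_cst c : jmeasurable_fun (fun=> c).
Proof. by move=> d T phi _; exact: measurable_cst. Qed.

Lemma jmeasurable_coord i : jmeasurable_fun (fun z => z i).
Proof. by move=> d T phi; exact. Qed.

Lemma jmeasurable_sum (I : Type) (r : seq I) (f : I -> (nat -> R) -> R) :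
  (forall i, jmeasurable_fun (f i)) -> jmeasurable_fun (fun z => \sum_(i <- r) f i z).
Proof. by move=> mf d T phi mphi; apply: measurable_sum => i; exact: mf. Qed.

Lemma jmeasurable_prod (I : Type) (r : seq I) (f : I -> (nat -> R) -> R) :
  (forall i, jmeasurable_fun (f i)) -> jmeasurable_fun (fun z => \prod_(i <- r) f i z).
Proof.
move=> mf d T phi mphi; elim: r => [|i r IH].
  by rewrite (_ : (fun t => _) = cst 1)//; apply/funext => t; rewrite big_nil.
rewrite (_ : (fun t => _) = (fun t => f i (phi t) * \prod_(j <- r) f j (phi t))).
  by apply: measurable_funM => //; exact: mf.
by apply/funext => t; rewrite big_cons.
Qed.

Lemma jmeasurable_EFin f : jmeasurable_fun f -> jmeasurable (fun z => (f z)%:E).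
Proof. by move=> mf d T phi mphi; apply/measurable_EFinP; exact: mf. Qed.

Lemma iint_ge0 m (f : (nat -> R) -> \bar R) :
  (forall z, 0 <= f z)%E -> (0 <= iint m f)%E.
Proof.
elim: m f => [|b m IH] f f0 /=; first exact: f0.
by case: b; [apply: integral_ge0 => x _|]; apply: IH.
Qed.

(** The parameter space [T] is arbitrary so that the induction on [m] can absorb each integration
    variable into it, passing from [T] to [T * R]; Tonelli then integrates that variable out. *)
Lemma jmeasurable_iint d (T : measurableType d) m (G : T -> (nat -> R) -> \bar R) :
  (forall x z, 0 <= G x z)%E ->
  (forall d' (T' : measurableType d') (phi : T' -> nat -> R) (x : T' -> T),
     measurable_coords phi -> measurable_fun setT x ->
     measurable_fun setT (fun t => G (x t) (phi t))) ->
  measurable_fun setT (fun x => iint m (G x)).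
Proof.
elim: m d T G => [|b m IH] d T G G0 mG /=.
  by apply: (mG _ _ (fun _ _ => 0) id).
case: b; last first.
  apply: IH => // d' T' phi x mphi mx.
  by apply: mG => //; exact: measurable_coords_scons.
pose F (p : T * measurableTypeR R) := iint m (fun v => G p.1 (scons p.2 v)).
have mF : measurable_fun setT F.
  apply: (IH _ _ (fun (p : T * measurableTypeR R) v => G p.1 (scons p.2 v))) => //.
  move=> d' T' phi x mphi mx; apply: mG.
  - by apply: measurable_coords_scons => //; exact: measurableT_comp mx.
  - exact: measurableT_comp mx.
have F0 p : (0 <= F p)%E by exact: iint_ge0.
exact: (@measurable_fun_fubini_tonelli_F _ _ _ _ _ mu _ mF F0).
Qed.

Lemma eq_iint m (f g : (nat -> R) -> \bar R) : f =1 g -> iint m f = iint m g.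
Proof. by move=> /funext ->. Qed.

Lemma iint_measurable_scons m f : (forall z, 0 <= f z)%E -> jmeasurable f ->
  measurable_fun [set: R] (fun x => iint m (fun v => f (scons x v))).
Proof.
move=> f0 mf.
apply: (@jmeasurable_iint _ (measurableTypeR R) m (fun x v => f (scons x v))) => //.
by move=> d' T' phi x mphi mx; apply: (jmeasurable_scons mf).
Qed.

Lemma iintZl m (c : R) f : 0 <= c -> (forall z, 0 <= f z)%E -> jmeasurable f ->
  iint m (fun z => c%:E * f z)%E = (c%:E * iint m f)%E.
Proof.
move=> c0; elim: m f => [//|[] m IH] f f0 mf /=; last first.
  by rewrite IH//; exact: jmeasurable_sconsx.
rewrite -ge0_integralZl//.
- apply: eq_integral => x _; rewrite IH//; exact: jmeasurable_sconsx.
- exact: iint_measurable_scons.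
- by move=> x _; exact: iint_ge0.
Qed.

End JointMeasurability.

(** * The averaging operators, their commutation and their iterates *)

Section RunningMaximum.
Variable R : realType.
Local Notation mu := (@lebesgue_measure R).
Local Notation J x := ((\1_`[0%R, 1%R]%classic x : R)%:E).
Local Open Scope ereal_scope.

Definition maxstep (k : nat) (g : (nat -> R) -> \bar R) (z : nat -> R) : \bar R :=
  \int[mu]_x (J x * g (upd z k (Num.max (z k) x))).

Lemma maxstep_ge0 k g : (forall z, 0 <= g z) -> forall z, 0 <= maxstep k g z.
Proof. by move=> g0 z; apply: integral_ge0 => x _; rewrite mule_ge0// lee_fin. Qed.

Lemma measurable_J : measurable_fun [set: R] (fun x : R => J x).
Proof. exact: measurable_indicE. Qed.

Lemma measurable_upd_max g d (T : measurableType d) (phi : T -> nat -> R) k (x : T -> R) :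
  jmeasurable g -> measurable_coords phi -> measurable_fun setT x ->
  measurable_fun setT (fun t => J (x t) * g (upd (phi t) k (Num.max (phi t k) (x t)))).
Proof.
move=> mg mphi mx; apply: emeasurable_funM.
  exact: (measurableT_comp measurable_J).
by apply: mg; apply: measurable_coords_upd => //; exact: measurable_maxr.
Qed.

Lemma jmeasurable_maxstep k g : (forall z, 0 <= g z) -> jmeasurable g ->
  jmeasurable (maxstep k g).
Proof.
move=> g0 mg; apply: jmeasurable_integral => [x z|d T phi x mphi mx].
  by rewrite mule_ge0// lee_fin.
exact: measurable_upd_max.
Qed.

(** For [j != k] the two moves update different coordinates and neither reads what the other writes,
    so only the order of integration changes. *)
Lemma maxstepC j k g : (forall z, 0 <= g z) -> jmeasurable g ->
  maxstep j (maxstep k g) = maxstep k (maxstep j g).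
Proof.
move=> g0 mg; have [->//|jk] := eqVneq j k; apply/funext => z.
rewrite /maxstep.
have mc w : measurable_coords (fun _ : measurableTypeR R => w : nat -> R).
  by move=> i; exact: measurable_cst.
pose F (p : measurableTypeR R * measurableTypeR R) := J p.1 * (J p.2 *
  g (upd (upd z j (Num.max (z j) p.1)) k (Num.max (z k) p.2))).
have F0 p : 0 <= F p by rewrite !mule_ge0// lee_fin.
have mF : measurable_fun setT F.
  apply: emeasurable_funM; first exact: (measurableT_comp measurable_J).
  apply: emeasurable_funM; first exact: (measurableT_comp measurable_J).
  apply: mg; do 2 (apply: measurable_coords_upd; last exact: measurable_maxr).
  by move=> i; exact: measurable_cst.
have zkx x : upd z j x k = z k by rewrite /upd eq_sym (negbTE jk).
have zjx x : upd z k x j = z j by rewrite /upd (negbTE jk).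
transitivity (\int[mu]_x \int[mu]_y F (x, y)).
  apply: eq_integral => x _; rewrite /F/= ge0_integralZl ?lee_fin//.
  - by congr (_ * _); apply: eq_integral => y _; rewrite zkx.
  - apply: emeasurable_funM; first exact: measurable_J.
    apply: mg; apply: measurable_coords_upd; last exact: measurable_maxr.
    by move=> i; exact: measurable_cst.
  - by move=> y _; rewrite mule_ge0// lee_fin.
rewrite (fubini_tonelli F mF)//.
apply: eq_integral => y _; rewrite /F/= -ge0_integralZl ?lee_fin//.
- apply: eq_integral => x _; rewrite zjx updC// !muleA.
  by rewrite [J x * _]muleC.
- exact: (measurable_upd_max j mg (mc (upd z k (Num.max (z k) y)))
    (@measurable_id _ (measurableTypeR R) setT)).
- by move=> x _; rewrite mule_ge0// lee_fin.
Qed.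

Lemma foldr_maxstep_wf s g : (forall z, 0 <= g z) -> jmeasurable g ->
  (forall z, 0 <= foldr maxstep g s z) /\ jmeasurable (foldr maxstep g s).
Proof.
move=> g0 mg; elim: s => [//|k s [IH1 IH2]] /=.
by split; [exact: maxstep_ge0|exact: jmeasurable_maxstep].
Qed.

Lemma foldr_maxstep_perm s1 s2 g : (forall z, 0 <= g z) -> jmeasurable g ->
  perm_eq s1 s2 -> foldr maxstep g s1 = foldr maxstep g s2.
Proof.
move=> g0 mg; elim: s1 s2 => [|k s1 IH] s2.
  by rewrite perm_sym => /perm_nilP ->.
move=> p; have ks2 : k \in s2 by rewrite -(perm_mem p) mem_head.
case/path.splitPr: ks2 p => a c p.
have {}p : perm_eq s1 (a ++ c).
  by move: p; rewrite perm_sym -cat1s perm_catCA cat1s perm_cons perm_sym.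
rewrite /= (IH _ p) !foldr_cat.
have [h0 mh] := foldr_maxstep_wf c g0 mg.
(* The head step [maxstep k] travels inward past the steps of [a], one commutation at a time. *)
elim: a {p IH} => [//|j a IHa] /=; rewrite -IHa maxstepC//.
- by move=> z; apply: (foldr_maxstep_wf _ _ _).1.
- by apply: (foldr_maxstep_wf _ _ _).2.
Qed.

(** Starting from [z k = 0] makes the first maximum equal to the observation itself. The induction
    peels off the innermost step by applying the hypothesis to [maxstep k g], and
    [integral_max_exprn] raises the density by one degree. *)
Lemma iter_maxstep N k g z : (forall z, 0 <= g z) -> jmeasurable g -> z k = 0%R ->
  iter N.+1 (maxstep k) g z =
  \int[mu]_x (J x * (N.+1%:R * x ^+ N)%:E * g (upd z k x)).
Proof.
move=> + + zk; elim: N g => [|N IH] g g0 mg.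
  rewrite /= /maxstep; apply: eq_integral => x _; rewrite expr0 mulr1 mule1 zk.
  rewrite indicE mem_setE in_itv/=; case: (boolP (0 <= x)%R) => /= x0; last by rewrite !mul0e.
  by rewrite max_r.
rewrite iterSr IH; [|exact: maxstep_ge0|exact: jmeasurable_maxstep].
rewrite -(@integral_max_exprn R N (fun x => g (upd z k x))).
- apply: eq_integral => t _; congr (_ * _).
  by apply: eq_integral => x _; rewrite upd_eq upd_upd.
- apply: (mg _ _ (fun x : measurableTypeR R => upd z k x)).
  apply: (@measurable_coords_upd _ _ (measurableTypeR R) (fun _ => z) k id).
  - by move=> i; exact: measurable_cst.
  - exact: measurable_id.
- by move=> x; exact: g0.
Qed.

(** The list [s] holds the categories and [u] the uniform values of the successive observations. The
    shift of [u] mirrors [scons], so that the recursion follows that of [iint]. *)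
Fixpoint running_max (z : nat -> R) (s : seq nat) (u : nat -> R) : nat -> R :=
  if s is k :: s' then running_max (upd z k (Num.max (z k) (u 0%N))) s' (fun i => u i.+1) else z.

Lemma iint0 m : iint m (fun=> 0) = 0 :> \bar R.
Proof. by elim: m => [//|[] m /= ->//]; rewrite integral0. Qed.

(** The outermost integral is over the first observation, which is also the outermost operator of
    the fold; the constraint of the cube on that coordinate becomes the indicator in [maxstep]. *)
Lemma iint_running_max s g z :
  iint (nseq (size s) true) (fun u =>
    if `[< forall i, (i < size s)%N -> (0 <= u i <= 1)%R >] then g (running_max z s u) else 0)
  = foldr maxstep g s z.
Proof.
elim: s z => [|k s IH] z /=; first by case: asboolP => //; case.
rewrite /maxstep; apply: eq_integral => x _.
rewrite -IH indicE mem_setE in_itv/=.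
case: (boolP (0 <= x <= 1)%R) => x01 /=.
- rewrite mul1e; apply: eq_iint => v; congr (if _ then _ else _).
  apply/asboolP/asboolP => h i; first by move=> ?; exact: (h i.+1).
  by case: i => // i; exact: h.
- rewrite mul0e -[RHS](iint0 (nseq (size s) true)); apply: eq_iint => v.
  by case: asboolP => // /(_ 0%N isT) /=; rewrite (negbTE x01).
Qed.

(** State halfway through the categories: those below [p] are settled in [z], the others are still
    variables of an [iint], which numbers them from 0. *)
Definition splice p (z v : nat -> R) : nat -> R := fun i => if (i < p)%N then z i else v (i - p)%N.

(* Density of the maximum of [N] uniform variables; [1] for [N = 0], where
   [iint] does not integrate over the coordinate. *)
Definition max_density (N : nat) (x : R) : R := 
  if N is N'.+1 then (\1_`[0%R, 1%R]%classic x : R) * (N%:R * x ^+ N') else 1.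

Lemma max_density_ge0 N x : (0 <= max_density N x)%R.
Proof.
case: N => //= N; rewrite indicE mem_setE in_itv/=.
by case: (boolP (0 <= x <= 1)%R) => [/andP[x0 _]|_]; rewrite ?mul0r// mul1r mulr_ge0// exprn_ge0.
Qed.

Lemma measurable_max_density N : measurable_fun setT (max_density N : R -> R).
Proof.
case: N => [|N]; first exact: measurable_cst.
apply: measurable_funM; first exact: measurable_indic.
by apply: measurable_funM => //; exact: measurable_funX.
Qed.

Lemma jmeasurable_max_density (N k : nat) : jmeasurable_fun (fun z => max_density N (z k)).
Proof.
by move=> d T phi mphi; exact: (measurableT_comp (measurable_max_density N) (mphi k)).
Qed.

(** Induction on the number [r] of remaining categories. The coordinates from [p] on start at 0, so
    each block of equal steps falls under [iter_maxstep] and becomes one integral. *)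
Lemma foldr_maxstep_iint (N : nat -> nat) r p g z :
  (forall z, 0 <= g z) -> jmeasurable g -> (forall i, (p <= i)%N -> z i = 0%R) ->
  foldr maxstep g (flatten [seq nseq (N k) k | k <- iota p r]) z =
  iint [seq (0 < N k)%N | k <- iota p r]
   (fun v => (\prod_(k <- iota p r) max_density (N k) (splice p z v k))%:E * g (splice p z v)).
Proof.
move=> g0 mg; elim: r p z => [|r IH] p z zp /=.
  rewrite big_nil mul1e; congr g; apply/funext => i; rewrite /splice.
  by case: ltnP => // /zp.
rewrite foldr_cat.
set G := foldr maxstep g _.
have [G0 mG] : (forall z, 0 <= G z) /\ jmeasurable G by exact: foldr_maxstep_wf.
have -> : foldr maxstep G (nseq (N p) p) = iter (N p) (maxstep p) G.
  by elim: (N p) => //= n ->.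
have pcatE x v : splice p z (scons x v) = splice p.+1 (upd z p x) v.
  apply/funext => i; rewrite /splice /upd ltnS.
  case: (ltngtP i p) => [//|pi|->]; last by rewrite subnn.
  by rewrite -(subnSK pi).
have pE x v : splice p.+1 (upd z p x) v p = x by rewrite /splice ltnSn upd_eq.
have zpS x i : (p < i)%N -> upd z p x i = 0%R.
  by move=> pi; rewrite /upd gtn_eqF// zp// ltnW.
(* An empty category has no step and leaves [z p = 0], in agreement with the value that [iint] gives
   to an unflagged coordinate. *)
case Np : (N p) => [|n].
  rewrite /= /G IH; last by move=> i pi; apply: zp; exact: ltnW.
  apply: eq_iint => v; rewrite pcatE big_cons Np mul1r.
  rewrite (_ : upd z p 0 = z)//; apply/funext => i; rewrite /upd.
  by case: eqP => // ->; rewrite zp.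
rewrite iter_maxstep//; last exact: zp.
apply: eq_integral => x _; rewrite /G IH; last exact: zpS.
rewrite -EFinM -/(max_density n.+1 x) -iintZl.
- apply: eq_iint => v; rewrite big_cons pcatE pE Np muleA EFinM.
  by [].
- exact: max_density_ge0.
- move=> v; rewrite mule_ge0// lee_fin; apply: prodr_ge0 => k _; exact: max_density_ge0.
- have mpcat d (T : measurableType d) (phi : T -> nat -> R) :
    measurable_coords phi ->
    measurable_coords (fun t => splice p.+1 (upd z p x) (phi t)).
    by move=> mphi i; rewrite /splice; case: (i < p.+1)%N.
  apply: jmeasurableM => [|d T phi mphi]; last by apply: mg; exact: mpcat.
  move=> d T phi mphi.
  exact: (@jmeasurable_EFin _ _ (jmeasurable_prod (iota p.+1 r)
   (fun k => jmeasurable_max_density (N k) k)) _ _ _ (mpcat _ _ _ mphi)).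
Qed.

End RunningMaximum.

(** * Null sets for iterated integrals *)

Section IteratedAlmostEverywhere.
Variable R : realType.
Local Notation mu := (@lebesgue_measure R).
Implicit Types P Q : (nat -> R) -> Prop.

#[local] Instance filter_ae_lebesgue : Filter (nbhs (almost_everywhere mu)).
Proof. exact: (ae_filter_ringOfSetsType mu). Qed.

(* [P] holds almost everywhere for the measure integrated by [iint m], in Fubini form. *)
Fixpoint iae (m : seq bool) P : Prop :=
  match m with
  | [::] => P (fun=> 0)
  | b :: m' =>
      if b then {ae mu, forall x, iae m' (fun v => P (scons x v))}
      else iae m' (fun v => P (scons 0 v))
  end.

Lemma iaeT m P : (forall z, P z) -> iae m P.
Proof.
elim: m P => [|[] m IH] P Pz /=; [exact: Pz| |exact: IH].
by apply/aeW => x; exact: IH.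
Qed.

Lemma iaeS m P Q : (forall z, P z -> Q z) -> iae m P -> iae m Q.
Proof.
elim: m P Q => [|[] m IH] P Q PQ /=; [exact: PQ| |by apply: IH => v; exact: PQ].
by apply: filterS => x; apply: IH => v; exact: PQ.
Qed.

Lemma iaeI m P Q : iae m P -> iae m Q -> iae m (fun z => P z /\ Q z).
Proof.
elim: m P Q => [|[] m IH] P Q /=; [by []| |exact: IH].
by apply: filterS2 => x; exact: IH.
Qed.

Lemma iae_forall (I : finType) m (P : I -> (nat -> R) -> Prop) :
  (forall i, iae m (P i)) -> iae m (fun z => forall i, P i z).
Proof.
elim: m P => [|[] m IH] P /= aeP; [exact: aeP| |exact: IH].
by apply: filterS (filter_forall _ aeP) => x Px; exact: IH.
Qed.

(** Equality descends one coordinate at a time: for almost every outer value the inner integrals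
    agree by induction. *)
Lemma eq_iint_ae m (f g : (nat -> R) -> \bar R) :
  (forall z, 0 <= f z)%E -> jmeasurable f -> (forall z, 0 <= g z)%E -> jmeasurable g ->
  iae m (fun z => f z = g z) -> iint m f = iint m g.
Proof.
elim: m f g => [//|[] m IH] f g f0 mf g0 mg /= fg; last first.
  by apply: IH => //; exact: jmeasurable_sconsx.
apply: ae_eq_integral => //; [exact: iint_measurable_scons..|].
by apply: filterS fg => x fgx _; apply: IH => //; exact: jmeasurable_sconsx.
Qed.

Lemma ae_neq (c : R) : {ae mu, forall x, x != c}.
Proof.
exists [set c]; split => //; first exact: lebesgue_measure_set1.
by move=> x /= /negP; rewrite negbK => /eqP.
Qed.

Lemma iae_coord m k (c : R) : nth false m k -> iae m (fun z => z k != c).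
Proof.
elim: m k => [|b m IH] [|k] //=.
- by move=> ->; apply: filterS (ae_neq c) => x xc; exact: iaeT.
- move=> mk; case: b; last exact: (IH k).
  by apply/aeW => x; exact: (IH k).
Qed.

Lemma iae_coord0 m k : ~~ nth false m k -> iae m (fun z => z k = 0).
Proof.
elim: m k => [//|b m IH] [|k] /=.
- by move=> /negbTE ->; exact: iaeT.
- move=> mk; case: b; last exact: (IH k).
  by apply/aeW => x; exact: (IH k).
Qed.

(** If the first coordinate x is integrated, almost every x differs from [c], so the remaining sum
    must avoid the nonzero value [c - x]. The condition on [c] covers masks without integrated
    coordinates, where the sum is 0. *)
Lemma iae_sum m (c : R) : c != 0 -> iae m (fun z => \sum_(k < size m) z k != c).
Proof.
elim: m c => [|b m IH] c c0 /=; first by rewrite big_ord0 eq_sym.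
have sumE x v : (\sum_(k < (size m).+1) scons x v k != c) =
    (\sum_(k < size m) v k != c - x).
  by rewrite big_ord_recl /= [in RHS]eq_sym subr_eq addrC eq_sym.
case: b.
- apply: filterS (ae_neq c) => x xc.
  apply: iaeS (IH (c - x) _) => [v|]; first by rewrite sumE.
  by rewrite subr_eq0 eq_sym.
- by apply: iaeS (IH c c0) => v; rewrite sumE subr0.
Qed.

End IteratedAlmostEverywhere.

(** * Pointwise description of the running maximum, and sorting a list by value *)

Section RunningMaximumBounds.
Variable R : realType.
Implicit Types (z u : nat -> R) (s : seq nat).

Lemma running_max_ge z s u k : z k <= running_max z s u k.
Proof.
elim: s z u => [//|j s IH] z u /=; apply: le_trans (IH _ _).
by rewrite /upd; case: eqP => // <-; rewrite le_max lexx.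
Qed.

Lemma running_max_ub z s u i : (i < size s)%N -> u i <= running_max z s u (nth 0%N s i).
Proof.
elim: s z u i => [//|j s IH] z u [|i] /=; last by move=> ?; exact: IH.
by move=> _; apply: le_trans (running_max_ge _ _ _ _); rewrite upd_eq le_max lexx orbT.
Qed.

Lemma running_max_attained z s u k : running_max z s u k = z k \/
  exists i, [/\ (i < size s)%N, nth 0%N s i = k & running_max z s u k = u i].
Proof.
elim: s z u => [|j s IH] z u /=; first by left.
have [->|[i [si sk ->]]] := IH (upd z j (Num.max (z j) (u 0%N))) (fun i => u i.+1).
- rewrite /upd; case: eqP => [->|_]; last by left.
  by case: leP => _; [right; exists 0%N|left].
- by right; exists i.+1.
Qed.

End RunningMaximumBounds.

(** Both lists contain each value equally often. This is what groups the observations by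
    category. *)
Lemma perm_flatten_nseq (T : eqType) (s r : seq T) : uniq r -> {subset s <= r} ->
  perm_eq s (flatten [seq nseq (count_mem k s) k | k <- r]).
Proof.
move=> ur sr; apply/allP => k _ /=.
have -> (N : T -> nat) : count_mem k (flatten [seq nseq (N j) j | j <- r]) =
    if k \in r then N k else 0%N.
  elim: r ur {sr} => //= j r IH /andP[jr ur].
  rewrite count_cat count_nseq IH//= in_cons [k == j]eq_sym.
  by case: eqP => [<-|_]; rewrite ?(negbTE jr) ?mul1n ?addn0// mul0n.
by case: ifPn => // /(contra (@sr k)) ks; apply/eqP/count_memPn.
Qed.

(** * The sample event in terms of the maxima, and its Dirichlet integral *)

Section SampleMaxima.
Variables (R : realType) (K n : nat) (X : 'I_n -> 'I_K).

Let s : seq nat := [seq val (X i) | i <- enum 'I_n].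

Let size_s : size s = n. Proof. by rewrite size_map size_enum_ord. Qed.

Let nth_s (i : 'I_n) : nth 0%N s i = X i.
Proof. by rewrite (nth_map i) ?size_enum_ord// nth_ord_enum. Qed.

Lemma cellcountE (k : 'I_K) : cellcount X k = count_mem (val k) s.
Proof.
rewrite /cellcount cardE /enum_mem size_filter /s count_map enumT.
apply: eq_count => i /=; apply/idP/eqP => [|/val_inj Xik].
  by rewrite inE/= => /eqP ->.
by rewrite inE/=; apply/eqP.
Qed.

Lemma cellcount_gt0 (k : 'I_K) : reflect (exists i, X i = k) (0 < cellcount X k)%N.
Proof.
apply: (iffP card_gt0P) => -[i]; first by rewrite inE => /eqP; exists i.
by exists i; rewrite inE; apply/eqP.
Qed.

Let box : set (nat -> R) := [set u | forall i, (i < n)%N -> 0 <= u i <= 1].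
Let M (u : nat -> R) := running_max (fun=> 0) s u.

Let M_ge0 u k : 0 <= M u k. Proof. exact: running_max_ge. Qed.

Let M_ub (u : nat -> R) (i : 'I_n) : u i <= M u (X i).
Proof. by rewrite -nth_s; apply: running_max_ub; rewrite size_s. Qed.

Let M_attained u k : M u k = 0 \/ exists i : 'I_n, X i = k :> nat /\ M u k = u i.
Proof.
have [|[i [si sk e]]] := running_max_attained (fun=> 0) s u k; first by left.
rewrite size_s in si; right; exists (Ordinal si); split => //.
by rewrite -nth_s.
Qed.

(** The maximum of an observed cell is either one of its values or 0; in the latter case [box u]
    gives 0 <= U_i < theta_k for an observation of that cell. *)
Lemma lt_sample_max u (th : 'I_K -> R) : box u ->
  (forall i : 'I_n, u i < th (X i)) <->
  (forall k : 'I_K, (0 < cellcount X k)%N -> M u k < th k).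
Proof.
move=> bu; split => [uth k /cellcount_gt0[i <-]|Mth i].
- have [->|[j [Xj ->]]] := M_attained u (X i).
    by apply: le_lt_trans (uth i); case/andP: (bu i (ltn_ord i)).
  by have <- : X j = X i by exact: val_inj.
- by apply: le_lt_trans (M_ub u i) (Mth _ _); apply/cellcount_gt0; exists i.
Qed.

Lemma eX_nonempty u : (0 < K)%N -> box u ->
  (eX (R := R) X u !=set0) <-> \sum_(k < K) M u k < 1.
Proof.
move=> K0 bu; split => [[th [[th0 th1] uth]]|M1].
- have Mth (k : 'I_K) : M u k <= th k.
    have [->//|[i [Xi ->]]] := M_attained u k.
    by have <- : X i = k by [exact: val_inj]; exact: ltW.
  (* An observed cell makes one of the inequalities strict; with no observation all maxima are 0 and
     the sum is 0 < 1. *)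
  have [[i0 _]|n0] := pselect (exists i : 'I_n, True); last first.
    rewrite big1 ?ltr01// => k _.
    by have [->//|[i]] := M_attained u k; case: n0; exists i.
  rewrite -th1 (bigD1 (X i0))//= [ltRHS](bigD1 (X i0))//=.
  apply: ltr_leD; last by apply: ler_sum => k _; exact: Mth.
  by apply: (lt_sample_max th bu).1 => //; apply/cellcount_gt0; exists i0.
(* The witness spreads the positive slack evenly over the [K] cells. *)
- have e0 : 0 < (1 - \sum_(k < K) M u k) / K%:R by rewrite divr_gt0 ?subr_gt0// ltr0n.
  exists (fun k => M u k + (1 - \sum_(k < K) M u k) / K%:R); split.
    split => [k|]; first by rewrite addr_ge0// ltW.
    rewrite big_split/= sumr_const card_ord -[X in _ + X]mulr_natr divfK; last by rewrite pnatr_eq0 -lt0n.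
    by rewrite addrC subrK.
  by move=> i; apply: le_lt_trans (M_ub u i) _; rewrite ltrDl.
Qed.

Variables (m : nat) (th : 'I_m -> 'I_K -> R) (b : 'I_m -> bool).

(** The conditioning event and the prescribed membership pattern, as a function of the vector of
    maxima. *)
Let g (z : nat -> R) : \bar R := indE ((forall k : 'I_K, 0 <= z k) /\
  (\sum_(k < K) z k < 1 /\
   forall j, (simplex (th j) /\ forall k : 'I_K, (0 < cellcount X k)%N -> z k < th j k) <-> b j)).

Let mg : jmeasurable g.
Proof.
apply: jmeasurable_indE; apply: jmeasurable_setI; last apply: jmeasurable_setI.
- apply: jmeasurable_set_forall => k.
  by apply: jmeasurable_ler; [exact: jmeasurable_fun_cst|exact: jmeasurable_coord].
- apply: jmeasurable_ltr; last exact: jmeasurable_fun_cst.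
  by apply: jmeasurable_sum => k; exact: jmeasurable_coord.
- apply: jmeasurable_set_forall => j; apply: jmeasurable_set_iff.
  apply: jmeasurable_setI; first exact: jmeasurable_set_cst.
  apply: jmeasurable_set_forall => k; apply: jmeasurable_set_imply.
  by apply: jmeasurable_ltr; [exact: jmeasurable_coord|exact: jmeasurable_fun_cst].
Qed.

Let E : set (nat -> R) := [set u | eX X u !=set0].
Let dom : set (nat -> R) := [set z | (forall k : 'I_K, 0 <= z k) /\ \sum_(k < K) z k <= 1].
Let w (z : nat -> R) : R := \prod_(k < K | (0 < cellcount X k)%N) z k ^+ (cellcount X k).-1.
Let mask := [seq (0 < cellcount X k)%N | k <- enum 'I_K].
Let c : R := \prod_(k < K | (0 < cellcount X k)%N) (cellcount X k)%:R.

Lemma iint_sample (K0 : (0 < K)%N) : iint (nseq n true) (fun u => indE (box u /\ E u /\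
    (forall j : 'I_m, eX X u (th j) <-> b j)))
  = foldr (@maxstep R) g s (fun=> 0).
Proof.
rewrite -iint_running_max size_s; apply: eq_iint => u.
have [bu|nbu] := pselect (box u); last first.
  rewrite [RHS]ifF; last exact/asboolP.
  by rewrite /indE asboolF// => -[].
rewrite [RHS]ifT; last exact/asboolP.
rewrite /g /indE; congr (if _ then _ else _); apply: asbool_equiv_eq.
rewrite -/(M u) /E/= eX_nonempty//.
have eXE j : eX X u (th j) <-> (simplex (th j) /\
    forall k : 'I_K, (0 < cellcount X k)%N -> M u k < th j k).
  by rewrite /eX/= (lt_sample_max (th j) bu).
split => [[_ [M1 h]]|[_ [M1 h]]]; (do 2 split => //) => j.
- by rewrite -eXE.
- by rewrite eXE.
Qed.

Let g2 (z : nat -> R) : \bar R :=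
  (indE (dom z /\ forall j : 'I_m, eN z (th j) <-> b j) * (w z)%:E)%E.

Let mask_val : mask = [seq (0 < count_mem k s)%N | k <- iota 0 K].
Proof.
by rewrite -val_enum_ord -map_comp; apply: eq_map => k /=; rewrite cellcountE.
Qed.

Let nth_mask (k : 'I_K) : nth false mask k = (0 < cellcount X k)%N.
Proof. by rewrite (nth_map k) ?size_enum_ord// nth_ord_enum. Qed.

Let jmeasurable_w : jmeasurable_fun w.
Proof.
move=> d T phi mphi.
rewrite (_ : (fun t => _) = (fun t => \prod_(k < K)
    if (0 < cellcount X k)%N then phi t k ^+ (cellcount X k).-1 else 1)).
  apply: (@jmeasurable_prod R 'I_K _ (fun (k : 'I_K) z =>
    if (0 < cellcount X k)%N then z k ^+ (cellcount X k).-1 else 1)) => // k.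
  move=> d' T' phi' mphi'; case: (0 < cellcount X k)%N; last exact: measurable_cst.
  exact: measurable_funX.
by apply/funext => t; rewrite /w big_mkcond.
Qed.

(* On this set of full measure the strict and the weak inequalities agree. *)
Let generic (z : nat -> R) := [/\ forall k : 'I_K, cellcount X k = 0%N -> z k = 0,
  forall (k : 'I_K) j, (0 < cellcount X k)%N -> z k != th j k &
  \sum_(k < K) z k != 1].

Let iae_generic : iae mask generic.
Proof.
have H1 : iae mask (fun z : nat -> R => forall k : 'I_K, cellcount X k = 0%N -> z k = 0).
  apply: (iae_forall (P := fun (k : 'I_K) z => cellcount X k = 0%N -> z k = 0)) => k.
  case: (posnP (cellcount X k)) => k0.
    by apply: iaeS (@iae_coord0 _ mask k _) => [z + _//|]; rewrite nth_mask k0.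
  by apply: iaeT => z k0'; rewrite k0' in k0.
have H2 : iae mask (fun z : nat -> R => forall (k : 'I_K) j, (0 < cellcount X k)%N -> z k != th j k).
  apply: (iae_forall (P := fun (k : 'I_K) z => forall j, (0 < cellcount X k)%N -> z k != th j k)) => k.
  apply: (iae_forall (P := fun j z => (0 < cellcount X k)%N -> z k != th j k)) => j.
  have [k0|k0] := posnP (cellcount X k); first exact: iaeT.
  by apply: iaeS (@iae_coord _ mask k (th j k) _) => [z + _//|]; rewrite nth_mask.
have H3 : iae mask (fun z : nat -> R => \sum_(k < K) z k != 1).
  by have := iae_sum mask (@oner_neq0 R); rewrite size_map size_enum_ord.
by apply: iaeS (iaeI H1 (iaeI H2 H3)) => z [? [? ?]].
Qed.

(** Sorting the steps gives one density per observed cell. The factors N_k are collected in [c] and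
    the powers in [w]; the integrands are then compared only at [generic] points. *)
Lemma iint_dirichlet : foldr (@maxstep R) g s (fun=> 0) = (c%:E * iint mask g2)%E.
Proof.
have g0 z : (0 <= g z)%E by exact: indE_ge0.
pose N k := count_mem k s.
have sN : perm_eq s (flatten [seq nseq (N k) k | k <- iota 0 K]).
  apply: perm_flatten_nseq; first exact: iota_uniq.
  by move=> k /mapP[i _ ->]; rewrite mem_iota /=.
rewrite (foldr_maxstep_perm _ _ sN)// foldr_maxstep_iint//.
have w0 z : dom z -> 0 <= w z.
  by move=> [z0 _]; apply: prodr_ge0 => k _; exact: exprn_ge0.
have g20 z : (0 <= g2 z)%E.
  rewrite /g2 /indE; case: asboolP => [[dz _]|_]; last by rewrite mul0e.
  by rewrite mul1e lee_fin w0.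
have mg2 : jmeasurable g2.
  apply: jmeasurableM; last exact: jmeasurable_EFin.
  apply: jmeasurable_indE; apply: jmeasurable_setI.
    apply: jmeasurable_setI.
    - apply: jmeasurable_set_forall => k.
      by apply: jmeasurable_ler; [exact: jmeasurable_fun_cst|exact: jmeasurable_coord].
    - apply: jmeasurable_ler; last exact: jmeasurable_fun_cst.
      by apply: jmeasurable_sum => k; exact: jmeasurable_coord.
  apply: jmeasurable_set_forall => j; apply: jmeasurable_set_iff.
  apply: jmeasurable_setI; first exact: jmeasurable_set_cst.
  apply: jmeasurable_set_forall => k.
  by apply: jmeasurable_ler; [exact: jmeasurable_coord|exact: jmeasurable_fun_cst].
have c0 : 0 <= c by apply: prodr_ge0 => k _; exact: ler0n.
rewrite -iintZl// -mask_val.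
have pcat0 v : splice 0 (fun=> 0 : R) v = v.
  by apply/funext => i; rewrite /splice subn0.
apply: eq_iint_ae.
- move=> z; apply: mule_ge0 => //; rewrite lee_fin; apply: prodr_ge0 => k _; exact: max_density_ge0.
- move=> d T phi mphi; under eq_fun do rewrite pcat0.
  apply: emeasurable_funM; last exact: mg.
  exact: (jmeasurable_EFin (jmeasurable_prod (iota 0 K)
     (fun k => jmeasurable_max_density (N k) k)) mphi).
- by move=> z; apply: mule_ge0.
- by apply: jmeasurableM => //; exact: jmeasurable_cst.
apply: iaeS iae_generic => z [z0 zth z1].
rewrite pcat0 /g2 /g.
(* Outside [dom] both indicators vanish. *)
have [dz|ndz] := pselect (dom z); last first.
  rewrite /indE !asboolF ?(mul0e, mule0)//; first by case.
  by case=> z0' [z1' _]; apply: ndz; split => //; exact: ltW.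
rewrite muleCA muleC; case: (dz) => zge0 zle1; congr (_ * _)%E.
- rewrite /indE; congr (if _ then _ else _); apply: asbool_equiv_eq.
  (* In an unobserved cell [z k = 0], so the weak inequality is the nonnegativity of a point of the
     simplex. *)
  have zth_iff j : eN z (th j) <-> (simplex (th j) /\
     forall k : 'I_K, (0 < cellcount X k)%N -> z k < th j k).
    split=> [[sj zj]|[sj zj]]; split => // k.
      by move=> k0; rewrite lt_neqAle zth//=.
    case: (posnP (cellcount X k)) => k0; last exact/ltW/zj.
    by rewrite (z0 k k0); exact: sj.1.
  split=> [[_ [_ h]]|[_ h]].
    by split => // j; rewrite zth_iff.
  split => //; split; first by rewrite lt_neqAle z1.
  by move=> j; rewrite -zth_iff.
(* On [dom] each coordinate is at most the sum, hence at most 1, so the indicator inside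
   [max_density] equals 1. *)
- rewrite -EFinM /c /w -big_split/=; congr (_%:E).
  rewrite -[K in iota 0 K](subn0 K) big_mkord [RHS]big_mkcond/=.
  apply: eq_bigr => k _; rewrite /N -cellcountE.
  case: (cellcount X k) => [//|N'] /=.
  rewrite indicE mem_setE in_itv/= zge0/= (le_trans _ zle1) ?mul1r//.
  by rewrite (bigD1 k)//= lerDl sumr_ge0.
Qed.

End SampleMaxima.

(** * Comparison of the two ratios *)

(** A positive factor preserves infinities and [fine] sends them to 0, so infinite values of [x] are
    covered too. *)
Lemma fine_pMl (R : realType) (c : R) (x : \bar R) :
  0 < c -> fine (c%:E * x)%E = c * fine x.
Proof.
by case: x => [x|//|] c0 //=; rewrite ?gt0_muley ?gt0_muleNy ?lte_fin//= mulr0.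
Qed.

(* Equality in law of the random sets e_X(U) (U conditioned) and e_N(Z),
   expressed as equality of all finite-dimensional distributions of the
   membership process theta |-> [theta in set]. *)
Theorem theorem1 (R : realType) (K n : nat) (X : 'I_n -> 'I_K)
  (m : nat) (th : 'I_m -> 'I_K -> R) (b : 'I_m -> bool) :
  (2 <= K)%N ->
  unif_cond_prob X [set u : nat -> R | forall j : 'I_m, eX X u (th j) <-> b j]
  = dirichlet_prob (cellcount X) [set z : nat -> R | forall j : 'I_m, eN z (th j) <-> b j].
Proof.
move=> K2; have K0 : (0 < K)%N by exact: ltnW.
have num := etrans (iint_sample X th b K0) (iint_dirichlet X th b).
(* With an empty family of test points the membership condition is vacuous, so the identity for the
   numerators also yields the one for the denominators. *)
pose th0 (j : 'I_0) : 'I_K -> R := fun=> 0; pose b0 (j : 'I_0) := true.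
have triv (P : 'I_0 -> Prop) (Q : Prop) : (Q /\ (forall j, P j)) = Q.
  by apply/propext; split => [[]//|q]; split => // -[].
have den : iint (nseq n true) (fun u : nat -> R =>
      indE ((forall i, (i < n)%N -> 0 <= u i <= 1) /\ eX X u !=set0)) =
    ((\prod_(k < K | (0 < cellcount X k)%N) (cellcount X k)%:R)%:E *
     iint [seq (0 < cellcount X k)%N | k <- enum 'I_K] (fun z : nat -> R =>
      indE ((forall k : 'I_K, (0 <= z k)%R) /\ (\sum_(k < K) z k <= 1)%R) *
      (\prod_(k < K | (0 < cellcount X k)%N) z k ^+ (cellcount X k).-1)%:E))%E.
  rewrite (@eq_iint R _ _ (fun u => indE ((forall i, (i < n)%N -> 0 <= u i <= 1) /\
      eX X u !=set0 /\ forall j, eX X u (th0 j) <-> b0 j))); last first.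
    by move=> u; rewrite triv.
  rewrite (iint_sample X th0 b0 K0) iint_dirichlet; congr (_ * _)%E.
  by apply: eq_iint => z; rewrite triv.
rewrite /unif_cond_prob /dirichlet_prob /= num den.
have c0 : 0 < \prod_(k < K | (0 < cellcount X k)%N) (cellcount X k)%:R :> R.
  by apply: prodr_gt0 => k; rewrite ltr0n.
(* The product of the positive cell counts is the same nonzero factor above and below, and
   cancels. *)
by rewrite !fine_pMl// -mulf_div divff ?mul1r// gt_eqF.
Qed.
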